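(* Let $\mathbb{K}=\mathbb{Q}$. For $m\in\mathbb{Q}$ let $$\psi_m:=\det\begin{pmatrix} y_1 & y_5+y_6 & y_5 & m y_6 \\ y_5+y_6 & y_2 & y_5 & y_6 \\ y_5 & y_5 & y_3 & 0 \\ m y_6 & y_6 & 0 & y_4 \end{pmatrix}\in\mathbb{Q}[y_1,\dots,y_6].$$ Then for $m,m'\in\mathbb{Q}^*$, one has $\psi_m\simeq\psi_{m'}$ if and only if $m=m'$ or $mm'=1$.
   Context: (Linear contact) equivalence: for polynomials $\phi\in\mathbb{K}[x_1,\dots,x_m]$ and $\psi\in\mathbb{K}[x_1,\dots,x_n]$ over a field $\mathbb{K}$, $\phi\simeq\psi$ means that for some $p\ge m,n$ there are $\ell\in\operatorname{GL}_p(\mathbb{K})$ and $\lambda\in\mathbb{K}^*$ with $\phi=\lambda\cdot\psi\circ\ell$ in $\mathbb{K}[x_1,\dots,x_p]$. Here $\mathbb{K}=\mathbb{Q}$. *)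

(* Defs.v *)
From mathcomp Require Export all_boot all_order all_algebra.
From mathcomp Require Export mpoly.

Set Implicit Arguments.
Unset Strict Implicit.
Unset Printing Implicit Defensive.

Import GRing.Theory.

Local Open Scope ring_scope.

Section LinearContactEquivalence.
Variable K : fieldType.

(* The inclusion K[x_1, ..., x_n] -> K[x_1, ..., x_p] for n <= p, x_i |-> x_i. *)
Definition mpoly_incl (n p : nat) (le_np : (n <= p)%N)
    (phi : {mpoly K[n]}) : {mpoly K[p]} :=
  phi \mPo [tuple 'X_(widen_ord le_np i) | i < n].

(* The composite psi \o l, where l acts on column vectors x by x |-> l *m x. *)
Definition mpoly_lin_comp (p : nat) (l : 'M[K]_p)
    (psi : {mpoly K[p]}) : {mpoly K[p]} :=
  psi \mPo [tuple \sum_(j < p) l i j *: 'X_j | i < p].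

Definition lin_contact_equiv (m n : nat)
    (phi : {mpoly K[m]}) (psi : {mpoly K[n]}) : Prop :=
  exists (p : nat) (le_mp : (m <= p)%N) (le_np : (n <= p)%N)
         (l : 'M[K]_p) (lam : K),
    [/\ l \in unitmx, lam != 0
      & mpoly_incl le_mp phi
        = lam *: mpoly_lin_comp l (mpoly_incl le_np psi)].

End LinearContactEquivalence.

(* y k is the k-th variable, numbered from 1: it is meant for 1 <= k <= 6. *)
Definition y (k : nat) : {mpoly rat[6]} := 'X_(inord k.-1).

Definition psi_mx (m : rat) : 'M[{mpoly rat[6]}]_4 :=
  \matrix_(i, j) nth 0 (nth [::]
    [:: [:: y 1;        y 5 + y 6;  y 5;  m *: y 6];
        [:: y 5 + y 6;  y 2;        y 5;  y 6     ];
        [:: y 5;        y 5;        y 3;  0       ];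
        [:: m *: y 6;   y 6;        0;    y 4     ]] i) j.

Definition psi (m : rat) : {mpoly rat[6]} := \det (psi_mx m).

(* Main.v *)
(** Restricting an equivalence to K[x_1, ..., x_6] gives a 6 x 6 matrix L with
    psi_m(v) = lam psi_m'(v L).  The points where all second partial derivatives
    of psi_m vanish are those where the symmetric matrix has rank at most one;
    they form six lines, spanned by v v^T for v = e1, e2, e3, (1,1,1,0), e4 and
    (m,1,0,m), which give a basis of the six-dimensional space.  L permutes these
    lines, so that in this basis it is a monomial matrix.  In the same basis
    psi_m is a multi-affine form, namely the configuration polynomial of these
    six vectors, and the cross ratios of its coefficients, which are invariant
    under rescaling, determine m up to inversion.  Conversely, exchanging y_1
    and y_2 and rescaling y_4 turns psi_m into a multiple of psi_(1/m). *)

Require Import Defs.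
From mathcomp Require Import ring lra.

Set Implicit Arguments.
Unset Strict Implicit.
Unset Printing Implicit Defensive.

Import Order.TTheory GRing.Theory Num.Theory.
Local Open Scope ring_scope.

Local Notation o k := (@Ordinal 6 k isT).

(** * Tools for six coordinates *)

Definition row6 (a b c d e f : rat) : 'rV[rat]_6 :=
  \row_k nth 0 [:: a; b; c; d; e; f] k.

Lemma ord6_ind (P : 'I_6 -> Prop) :
  P (o 0) -> P (o 1) -> P (o 2) -> P (o 3) -> P (o 4) -> P (o 5) ->
  forall i, P i.
Proof.
move=> P0 P1 P2 P3 P4 P5 [[|[|[|[|[|[|//]]]]]] lt_i6].
all: by rewrite (bool_irrelevance lt_i6 isT).
Qed.

Lemma sum6 (V : nmodType) (F : 'I_6 -> V) :
  \sum_i F i = F (o 0) + F (o 1) + F (o 2) + F (o 3) + F (o 4) + F (o 5).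
Proof.
rewrite !big_ord_recl big_ord0 addr0 !addrA.
by do !congr (_ + _); congr F; apply: val_inj.
Qed.

Lemma prod6 (R : comNzRingType) (P : pred 'I_6) (F : 'I_6 -> R) :
  \prod_(i | P i) F i =
  (if P (o 0) then F (o 0) else 1) * (if P (o 1) then F (o 1) else 1)
  * (if P (o 2) then F (o 2) else 1) * (if P (o 3) then F (o 3) else 1)
  * (if P (o 4) then F (o 4) else 1) * (if P (o 5) then F (o 5) else 1).
Proof.
rewrite big_mkcond /= !big_ord_recl big_ord0 mulr1 !mulrA.
by do !congr (_ * _); rewrite -[RHS]/((fun i => if P i then F i else 1) _);
   congr (if P _ then F _ else 1); apply: val_inj.
Qed.

(** * The expanded determinant *)

(** Stated over any commutative ring, so that one formula serves for polynomials and for their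
    values. *)
Definition psi_expr (R : comNzRingType) (m y1 y2 y3 y4 s t : R) : R :=
  y1 * y2 * y3 * y4 - y3 * y4 * (s + t) ^+ 2 - (y1 + y2) * y4 * s ^+ 2
  - (y1 + m ^+ 2 * y2) * y3 * t ^+ 2 + 2%:R * y4 * (s + t) * s ^+ 2
  + 2%:R * m * y3 * (s + t) * t ^+ 2 + (1 - m) ^+ 2 * s ^+ 2 * t ^+ 2.

(** With entries indexed by natural numbers, a minor has again this form, so Laplace expansion can
    be iterated by rewriting. *)
Lemma cofactor_mxE (R : comNzRingType) (n : nat) (f : nat -> nat -> R)
    (i j : 'I_n.+1) :
  cofactor (\matrix_(i, j) f i j) i j =
  (-1) ^+ (i + j) * \det (\matrix_(k < n, l < n) f (bump i k) (bump j l)).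
Proof. by congr (_ * \det _); apply/matrixP => k l; rewrite !mxE. Qed.

Lemma det_mx22E (R : comNzRingType) (f : nat -> nat -> R) :
  \det (\matrix_(i < 2, j < 2) f i j) =
  f 0%N 0%N * f 1%N 1%N - f 0%N 1%N * f 1%N 0%N.
Proof.
rewrite (expand_det_row _ ord0) !big_ord_recl big_ord0 !cofactor_mxE !det_mx11.
rewrite !mxE /= /bump /=; ring.
Qed.

Lemma det_mx33E (R : comNzRingType) (f : nat -> nat -> R) :
  \det (\matrix_(i < 3, j < 3) f i j) =
  f 0%N 0%N * (f 1%N 1%N * f 2%N 2%N - f 1%N 2%N * f 2%N 1%N)
  - f 0%N 1%N * (f 1%N 0%N * f 2%N 2%N - f 1%N 2%N * f 2%N 0%N)
  + f 0%N 2%N * (f 1%N 0%N * f 2%N 1%N - f 1%N 1%N * f 2%N 0%N).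
Proof.
rewrite (expand_det_row _ ord0) !big_ord_recl big_ord0 !cofactor_mxE
  !(det_mx22E (fun k l => f (bump _ k) (bump _ l))).
rewrite !mxE /= /bump /=; ring.
Qed.

Lemma psiE (m : rat) :
  psi m = psi_expr m%:MP (y 1) (y 2) (y 3) (y 4) (y 5) (y 6).
Proof.
rewrite /psi (expand_det_row _ ord0) !big_ord_recl big_ord0.
rewrite !(@cofactor_mxE _ 3 (fun i j => nth 0 (nth [::] _ i) j))
  !(det_mx33E (fun k l => nth 0 (nth [::] _ (bump _ k)) (bump _ l))).
rewrite !mxE /= /bump /= /psi_expr -!mul_mpolyC.
ring.
Qed.

Definition psi_fun (m : rat) (v : 'rV[rat]_6) : rat :=
  psi_expr m (v 0 (o 0)) (v 0 (o 1)) (v 0 (o 2)) (v 0 (o 3)) (v 0 (o 4))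
    (v 0 (o 5)).

Lemma rmorph_psi_expr (R S : comNzRingType) (f : {rmorphism R -> S})
    (m y1 y2 y3 y4 s t : R) :
  f (psi_expr m y1 y2 y3 y4 s t) =
  psi_expr (f m) (f y1) (f y2) (f y3) (f y4) (f s) (f t).
Proof.
rewrite /psi_expr.
by rewrite !(rmorphD, rmorphB, rmorphM, rmorphXn, rmorph_nat, rmorph1, rmorphN).
Qed.

Lemma psi_meval (m : rat) (v : 'rV[rat]_6) : (psi m).@[v 0] = psi_fun m v.
Proof.
rewrite psiE (rmorph_psi_expr (meval (v 0))) /psi_fun /y /=.
rewrite mevalC !mevalXU.
by rewrite -[o 0]inord_val -[o 1]inord_val -[o 2]inord_val -[o 3]inord_val
  -[o 4]inord_val -[o 5]inord_val.
Qed.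

(** * Restriction to six variables *)

Lemma equiv_psi_fun (m m' : rat) : lin_contact_equiv (psi m) (psi m') ->
  exists (L : 'M[rat]_6) (lam : rat),
    forall v : 'rV[rat]_6, psi_fun m v = lam * psi_fun m' (v *m L).
Proof.
case=> p [le_p [le_p' [l [lam [_ _ eq_psi]]]]].
(* [v *m E] pads a row with zeros; right multiplication by [E^T] keeps the first six entries. So [L]
   below is a corner block of [l^T]; its invertibility, not automatic, will follow from the form
   itself in [monomial_unitmx]. *)
pose E : 'M[rat]_(6, p) := \matrix_(i, j) (i == j :> nat)%:R.
have evE (le6 : (6 <= p)%N) q (w : 'cV[rat]_p) :
    (mpoly_incl le6 q).@[fun i => w i 0] = q.@[((E *m w)^T : 'rV[rat]_6) 0].
  rewrite comp_mpoly_meval; apply: meval_eq => i.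
  rewrite tnth_mktuple mevalXU !mxE (bigD1 (widen_ord le6 i)) //=.
  rewrite mxE /= eqxx mul1r big1 ?addr0 // => j; rewrite mxE -val_eqE /= eq_sym.
  by move/negPf->; rewrite mul0r.
exists (E *m l^T *m E^T), lam => v.
have := congr1 (fun q => q.@[fun i => (v *m E)^T i 0]) eq_psi.
have -> : (mpoly_incl le_p (psi m)).@[fun i => (v *m E)^T i 0] = psi_fun m v.
  rewrite evE -psi_meval; apply: meval_eq => i; congr (fun_of_matrix _ _ i).
  rewrite trmx_mul trmxK -mulmxA -[RHS]mulmx1; congr (_ *m _).
  apply/matrixP=> a b; rewrite !mxE (bigD1 (widen_ord le_p a)) //= !mxE /= eqxx.
  rewrite mul1r big1 ?addr0 1?eq_sym // => j; rewrite !mxE -val_eqE /= eq_sym.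
  by move/negPf->; rewrite mul0r.
move=> ->; rewrite mevalZ; congr (_ * _).
rewrite comp_mpoly_meval (@meval_eq _ _ _ (fun i => (l *m (v *m E)^T) i 0)).
  rewrite evE -psi_meval; apply: meval_eq => i; congr (fun_of_matrix _ _ i).
  by rewrite !trmx_mul !trmxK !mulmxA.
move=> i; rewrite tnth_mktuple raddf_sum mxE /=; apply: eq_bigr => j _.
by rewrite mevalZ mevalXU.
Qed.

(** * The form in the rank-one basis *)

(** This is psi_m / m in the coordinates of [basis_mx]. By Cauchy-Binet each coefficient is, up to
    the row scalings, the squared minor of four of the six vectors. *)
Definition basis_expr (m a b c d e f : rat) : rat :=
  (m - 2%:R + m^-1) * c * d * e * f + (m * b + m^-1 * a) * (c + d) * e * f
  + (e + f) * (a * b * (c + d) + c * d * (a + b)).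

Definition basis_fun (m : rat) (x : 'rV[rat]_6) : rat :=
  basis_expr m (x 0 (o 0)) (x 0 (o 1)) (x 0 (o 2)) (x 0 (o 3)) (x 0 (o 4))
    (x 0 (o 5)).

(* Row k holds the y-coordinates of a multiple of v v^T, where v runs over e1, e2,
   e3, (1,1,1,0), e4, (m,1,0,m).  The scalings of rows 4 and 5 make most of the
   coefficients of [basis_expr] equal to 1. *)
Definition basis_mx (m : rat) : 'M[rat]_6 :=
  \matrix_(i, j) nth 0 (nth [::]
    [:: [:: 1; 0;    0; 0; 0; 0];
        [:: 0; 1;    0; 0; 0; 0];
        [:: 0; 0;    1; 0; 0; 0];
        [:: 1; 1;    1; 0; 1; 0];
        [:: 0; 0;    0; m; 0; 0];
        [:: m; m^-1; 0; m; 0; 1]] i) j.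

Definition basis_inv_mx (m : rat) : 'M[rat]_6 :=
  \matrix_(i, j) nth 0 (nth [::]
    [:: [:: 1;   0;      0;   0; 0;    0];
        [:: 0;   1;      0;   0; 0;    0];
        [:: 0;   0;      1;   0; 0;    0];
        [:: 0;   0;      0;   0; m^-1; 0];
        [:: - 1; - 1;    - 1; 1; 0;    0];
        [:: - m; - m^-1; 0;   0; - 1;  1]] i) j.

Lemma psi_basis_mx (m : rat) (x : 'rV[rat]_6) : m != 0 ->
  psi_fun m (x *m basis_mx m) = m * basis_fun m x.
Proof.
move=> m0; rewrite /psi_fun /basis_fun !mxE !sum6 !mxE /=.
by rewrite /psi_expr /basis_expr; field.
Qed.

Lemma psi_basis_inv_mx (m : rat) (v : 'rV[rat]_6) : m != 0 ->
  psi_fun m v = m * basis_fun m (v *m basis_inv_mx m).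
Proof.
move=> m0; rewrite /psi_fun /basis_fun !mxE !sum6 !mxE /=.
by rewrite /psi_expr /basis_expr; field.
Qed.

Lemma equiv_basis_fun (m m' : rat) : m != 0 -> m' != 0 ->
  lin_contact_equiv (psi m) (psi m') ->
  exists (N : 'M[rat]_6) (lam : rat),
    forall x : 'rV[rat]_6, basis_fun m x = lam * basis_fun m' (x *m N).
Proof.
move=> m0 m'0 /equiv_psi_fun [L [lam eqL]].
exists (basis_mx m *m L *m basis_inv_mx m'), (lam * m' / m) => x.
have := eqL (x *m basis_mx m).
rewrite psi_basis_mx // psi_basis_inv_mx // !mulmxA => eqx.
by apply: (mulfI m0); rewrite eqx; field.
Qed.

(** * Points with vanishing second derivatives *)

(* As [basis_fun m] is a quartic form, this says that all its second partial
   derivatives vanish at p. *)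
Definition flat_at (m : rat) (p : 'rV[rat]_6) : Prop :=
  forall q : 'rV[rat]_6,
    basis_fun m (q + p) + basis_fun m (q - p) = 2%:R * basis_fun m q.

(** [basis_expr] has degree at most one in each variable, so second differences along an axis
    vanish. *)
Lemma flat_at_axis (m : rat) (p : 'rV[rat]_6) (i : 'I_6) :
  (forall j, j != i -> p 0 j = 0) -> flat_at m p.
Proof.
move=> p0 q; have [t pE] : exists t, forall j, p 0 j = t *+ (j == i).
  exists (p 0 i) => j; case: eqP => [-> //|/eqP]; exact: p0.
rewrite /basis_fun !mxE !pE /basis_expr.
by move: i {p0 pE}; apply: ord6_ind; rewrite ?mulr0n ?mulr1n; ring.
Qed.

(* Taking for q the sum of two unit vectors, and subtracting the case q = 0,
   isolates the corresponding mixed second derivative at (a, ..., f). *)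
Lemma basis_expr_flat (m a b c d e f : rat) : m != 0 ->
  (forall q0 q1 q2 q3 q4 q5 : rat,
    basis_expr m (q0 + a) (q1 + b) (q2 + c) (q3 + d) (q4 + e) (q5 + f)
    + basis_expr m (q0 - a) (q1 - b) (q2 - c) (q3 - d) (q4 - e) (q5 - f)
    = 2%:R * basis_expr m q0 q1 q2 q3 q4 q5) ->
  [/\ a * b = 0,
    [/\ a * c = 0, a * d = 0, b * c = 0 & b * d = 0],
    [/\ a * e = 0, a * f = 0, b * e = 0 & b * f = 0],
    [/\ c * e = 0, c * f = 0, d * e = 0 & d * f = 0] &
    c * d = 0 /\ e * f = 0].
Proof.
move=> m0 T; have T0 := T 0 0 0 0 0 0.
have mn : m * m^-1 = 1 by rewrite mulfV.
have h01 : (c + d) * (e + f) = 0.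
  have := T 1 1 0 0 0 0; move: T0; rewrite /basis_expr; lra.
have /eqP := h01; rewrite mulf_eq0 !addr_eq0 => /orP[] /eqP Ec.
- have d0 : d = 0.
    (* As c = -d, this mixed derivative reduces to c d = -d^2. *)
    have : d ^+ 2 = 0.
      have := T 0 1 0 0 1 0; move: T0; rewrite Ec /basis_expr; lra.
    by move/eqP; rewrite sqrf_eq0 => /eqP.
  have c0 : c = 0 by rewrite Ec d0 oppr0.
  have ha : b * (e + f) + m^-1 * e * f = 0.
    have := T 1 0 1 0 0 0; move: T0; rewrite c0 d0 /basis_expr; lra.
  have hb : a * (e + f) + m * e * f = 0.
    have := T 0 1 1 0 0 0; move: T0; rewrite c0 d0 /basis_expr; lra.
  have he : m * b * f + m^-1 * a * f + a * b = 0.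
    have := T 0 0 1 0 1 0; move: T0; rewrite c0 d0 /basis_expr; lra.
  have hf : m * b * e + m^-1 * a * e + a * b = 0.
    have := T 0 0 1 0 0 1; move: T0; rewrite c0 d0 /basis_expr; lra.
  (* By [ha] and [hb], the terms in m cancel and -2 e f = 0 remains. *)
  have ef : e * f = 0.
    have := T 0 0 1 1 0 0; move: T0; rewrite c0 d0 /basis_expr; lra.
  have /eqP := ef; rewrite mulf_eq0 => /orP[] /eqP Ee.
  + have bf : b * f = 0 by move: ha; rewrite Ee; lra.
    have af : a * f = 0 by move: hb; rewrite Ee; lra.
    have ab : a * b = 0 by move: he; rewrite -!mulrA bf af; lra.
    by rewrite c0 d0 Ee !(mulr0, mul0r).
  + have be : b * e = 0 by move: ha; rewrite Ee; lra.
    have ae : a * e = 0 by move: hb; rewrite Ee; lra.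
    have ab : a * b = 0 by move: hf; rewrite -!mulrA be ae; lra.
    by rewrite c0 d0 Ee !(mulr0, mul0r).
- have f0 : f = 0.
    have mf : m^-1 * f ^+ 2 = 0.
      have := T 1 0 1 0 0 0; move: T0; rewrite Ec /basis_expr; lra.
    by apply/eqP; rewrite -sqrf_eq0 -[_ ^+ 2]mul1r -mn -mulrA mf mulr0.
  have e0 : e = 0 by rewrite Ec f0 oppr0.
  have ha : b * (c + d) + c * d = 0.
    have := T 1 0 0 0 1 0; move: T0; rewrite e0 f0 /basis_expr; lra.
  have hb : a * (c + d) + c * d = 0.
    have := T 0 1 0 0 1 0; move: T0; rewrite e0 f0 /basis_expr; lra.
  have hc : a * b + d * (a + b) = 0.
    have := T 0 0 1 0 1 0; move: T0; rewrite e0 f0 /basis_expr; lra.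
  have hd : a * b + c * (a + b) = 0.
    have := T 0 0 0 1 1 0; move: T0; rewrite e0 f0 /basis_expr; lra.
  (* Substituting [ha] and [hb] into [hef] leaves -2 c d = 0. *)
  have cd : c * d = 0.
    have hef : (m - 2%:R + m^-1) * (c * d) + (m * b + m^-1 * a) * (c + d) = 0.
      have := T 0 0 0 0 1 1; move: T0; rewrite e0 f0 /basis_expr; lra.
    have mha : m * (b * (c + d) + c * d) = 0 by rewrite ha mulr0.
    have mhb : m^-1 * (a * (c + d) + c * d) = 0 by rewrite hb mulr0.
    lra.
  have /eqP := cd; rewrite mulf_eq0 => /orP[] /eqP Ec0.
  + have bd : b * d = 0 by move: ha; rewrite Ec0; lra.
    have ad : a * d = 0 by move: hb; rewrite Ec0; lra.
    have ab : a * b = 0 by move: hd; rewrite Ec0; lra.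
    by rewrite e0 f0 Ec0 !(mulr0, mul0r).
  + have bc : b * c = 0 by move: ha; rewrite Ec0; lra.
    have ac : a * c = 0 by move: hb; rewrite Ec0; lra.
    have ab : a * b = 0 by move: hc; rewrite Ec0; lra.
    by rewrite e0 f0 Ec0 !(mulr0, mul0r).
Qed.

(** With [flat_at_axis]: the flat points are exactly those on the six coordinate axes. *)
Lemma flat_at_orth (m : rat) (p : 'rV[rat]_6) : m != 0 -> flat_at m p ->
  forall i j, i != j -> p 0 i * p 0 j = 0.
Proof.
move=> m0 flatp.
have [|p01 [p02 p03 p12 p13] [p04 p05 p14 p15] [p24 p25 p34 p35] [p23 p45]] :=
    @basis_expr_flat m (p 0 (o 0)) (p 0 (o 1)) (p 0 (o 2)) (p 0 (o 3))
      (p 0 (o 4)) (p 0 (o 5)) m0.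
  move=> q0 q1 q2 q3 q4 q5; have := flatp (row6 q0 q1 q2 q3 q4 q5).
  by rewrite /basis_fun !mxE.
by do 2!apply: ord6_ind; rewrite // mulrC.
Qed.

(** * Coefficients indexed by omitted pairs *)

(* The coefficient in [basis_expr m] of the monomial omitting x_i and x_j. *)
Definition pair_coef (m : rat) (i j : 'I_6) : rat := nth 0 (nth [::]
  [:: [:: 0;                m - 2%:R + m^-1; m;    m;    1; 1];
      [:: m - 2%:R + m^-1;  0;               m^-1; m^-1; 1; 1];
      [:: m;                m^-1;            0;    0;    1; 1];
      [:: m;                m^-1;            0;    0;    1; 1];
      [:: 1;                1;               1;    1;    0; 0];
      [:: 1;                1;               1;    1;    0; 0]] i) j.

(** Each monomial is a product of four distinct variables, so at most one avoids both x_i and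
    x_j. *)
Lemma basis_fun_pair (m : rat) (x : 'rV[rat]_6) (i j : 'I_6) :
  i != j -> x 0 i = 0 -> x 0 j = 0 ->
  basis_fun m x = pair_coef m i j * \prod_(k | k \notin [:: i; j]) x 0 k.
Proof.
move: i j; do 2!apply: ord6_ind => //; move=> _ x0 x1.
all: rewrite prod6 /basis_fun /basis_expr /pair_coef /= x0 x1; ring.
Qed.

Definition off_pair (i j : 'I_6) : 'rV[rat]_6 :=
  \row_k (k \notin [:: i; j])%:R.

Lemma basis_fun_off_pair (m : rat) (i j : 'I_6) : i != j ->
  basis_fun m (off_pair i j) = pair_coef m i j.
Proof.
move=> ij; rewrite (basis_fun_pair m ij) ?mxE ?inE ?eqxx ?orbT //.
rewrite big1 ?mulr1 // => k kij; by rewrite mxE kij.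
Qed.

(** * Equivalences are monomial matrices *)

Section Monomial.
Variables (m m' lam : rat) (N : 'M[rat]_6).
Hypotheses (m0 : m != 0) (m'0 : m' != 0).
Hypothesis eqN :
  forall x, basis_fun m x = lam * basis_fun m' (x *m N).

Lemma scalar_neq0 : lam != 0.
Proof.
apply/eqP=> lam0; have := basis_fun_off_pair m (isT : o 0 != o 4).
by rewrite eqN lam0 mul0r.
Qed.

(* Otherwise [basis_fun m] would not depend on the i-th coordinate, while the
   monomial omitting x_j and x_k has a nonzero coefficient. *)
Lemma row_neq0 (i : 'I_6) : (delta_mx 0 i : 'rV_6) *m N != 0.
Proof.
(* One index from {0, 1} and one from {4, 5}, both different from [i]: the coefficient of such a
   pair is 1 for every m. *)
pose j := if i == o 0 then o 1 else o 0; pose k := if i == o 4 then o 5 else o 4.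
have [ij ik jk] : [/\ i != j, i != k & j != k].
  by rewrite /j /k; move: i {j k}; apply: ord6_ind.
apply/eqP=> iN0.
have : pair_coef m j k = basis_fun m (off_pair j k - delta_mx 0 i).
  by rewrite -basis_fun_off_pair // eqN [RHS]eqN mulmxBl iN0 subr0.
rewrite (basis_fun_pair m jk).
- rewrite (bigD1 i) ?inE ?negb_or ?ij ?ik //= !mxE !inE negb_or ij ik !eqxx.
  rewrite subrr mul0r mulr0.
  by move/eqP; rewrite /j /k; move: i {j k ij ik jk iN0}; apply: ord6_ind.
- by rewrite !mxE inE eqxx [j == i]eq_sym (negPf ij) subr0.
by rewrite !mxE !inE eqxx orbT [k == i]eq_sym (negPf ik) subr0.
Qed.

(** Translation by a kernel vector preserves [basis_fun m], so the vector is flat and lies on an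
    axis; [row_neq0] then forces it to be 0. *)
Lemma monomial_unitmx : N \in unitmx.
Proof.
rewrite -row_free_unit -kermx_eq0; apply/eqP/row_matrixP=> r; rewrite row0.
have : row r (kermx N) *m N = 0 by rewrite -row_mul mulmx_ker row0.
move: (row r _) => x xN.
have flatx : flat_at m x.
  by move=> q; rewrite !eqN mulmxDl mulmxBl xN addr0 subr0; ring.
apply/rowP=> i; rewrite [RHS]mxE; apply/eqP; apply: contraNT (row_neq0 i) => xi0.
have xE : x = x 0 i *: delta_mx 0 i.
  apply/rowP=> j; rewrite !mxE eqxx /=; case: eqP => [->|/eqP ji].
    by rewrite mulr1.
  have /eqP := flat_at_orth m0 flatx ji.
  by rewrite mulr0 mulf_eq0 (negPf xi0) orbF => /eqP.
by have /eqP := xN; rewrite xE -scalemxAl scaler_eq0 (negPf xi0).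
Qed.

(** As [N] is onto, it carries flat points for m to flat points for m', hence axes to axes. *)
Lemma row_monomial (i : 'I_6) :
  exists j, N i j != 0 /\ forall k, k != j -> N i k = 0.
Proof.
have flatN : flat_at m' ((delta_mx 0 i : 'rV_6) *m N).
  move=> q; apply: (mulfI scalar_neq0); rewrite mulrDr mulrCA.
  rewrite -(mulmxKV monomial_unitmx q) -mulmxDl -mulmxBl -!eqN.
  apply: (@flat_at_axis _ _ i) => j /negPf ji.
  by rewrite mxE ji andbF.
have /rV0Pn [j] := row_neq0 i; rewrite -rowE mxE => Nij.
exists j; split=> // k kj; have := flat_at_orth m'0 flatN kj.
by rewrite -rowE !mxE => /eqP; rewrite mulf_eq0 (negPf Nij) orbF => /eqP.
Qed.

(** Evaluating at [off_pair i j] leaves the product of the d_k over k other than i, j; the factor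
    d_i d_j completes it to the full product, which is absorbed in [mu]. *)
Lemma pair_coef_monomial :
  exists (s : 'I_6 -> 'I_6) (d : 'I_6 -> rat) (mu : rat),
  [/\ injective s, forall i, d i != 0, mu != 0 &
    forall i j, i != j ->
      pair_coef m i j * (d i * d j) = mu * pair_coef m' (s i) (s j)].
Proof.
have /fin_all_exists [s sP] := row_monomial.
pose d i := N i (s i).
have d0 i : d i != 0 by have [] := sP i.
have NE i k : N i k = d i *+ (k == s i).
  by have [_ /(_ k)] := sP i; case: eqP => [->|_ ->].
have s_inj : injective s.
  move=> i j sij; apply/eqP; apply: contraT => ij.
  (* If s i = s j, rows i and j of [N] are proportional, against invertibility. *)
  have : (d j *: delta_mx 0 i - d i *: delta_mx 0 j : 'rV_6) *m N = 0.
    apply/rowP=> k; rewrite mulmxBl -!scalemxAl -!rowE !mxE !NE sij.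
    by case: eqP => _; rewrite ?mulr0n ?mulr1n; ring.
  move/(canRL (mulmxK monomial_unitmx)); rewrite mul0mx => /rowP/(_ i).
  rewrite !mxE !eqxx (negPf ij) mulr0 subr0 mulr1 => /eqP.
  by rewrite (negPf (d0 j)).
exists s, d, (lam * \prod_i d i); split=> //.
  by rewrite mulf_neq0 ?scalar_neq0 //; apply/prodf_neq0 => i _; exact: d0.
move=> i j ij; rewrite -basis_fun_off_pair // eqN.
have zE k : (off_pair i j *m N) 0 (s k) = (k \notin [:: i; j])%:R * d k.
  rewrite mxE (bigD1 k) //= big1 ?addr0.
    by rewrite mxE NE eqxx mulr1n.
  by move=> l lk; rewrite NE (inj_eq s_inj) eq_sym (negPf lk) mulr0n mulr0.
have sij : s i != s j by rewrite (inj_eq s_inj).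
rewrite (basis_fun_pair m' sij) ?zE ?inE ?eqxx ?orbT ?mul0r //.
rewrite (reindex_inj s_inj) /=.
rewrite (eq_big (fun k => k \notin [:: i; j]) d); last 2 first.
- by move=> k; rewrite !inE !(inj_eq s_inj).
- by move=> k; rewrite zE !inE !(inj_eq s_inj) => ->; rewrite mul1r.
rewrite (eq_bigl (fun k => (k != i) && (k != j))); last first.
  by move=> k; rewrite !inE negb_or.
rewrite [\prod_i d i](bigD1 i) //= [\prod_(k | k != i) _](bigD1 j) 1?eq_sym //=.
ring.
Qed.

End Monomial.

(** * Recovering m from cross ratios *)

Lemma add_inv_sub2E (m : rat) : m != 0 -> m - 2%:R + m^-1 = (m - 1) ^+ 2 / m.
Proof. by move=> m0; field. Qed.

(** The off-diagonal zeros are at {2, 3}, {4, 5} and, only for m = 1, {0, 1}. This pattern detects m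
    = 1 and otherwise singles out the indices 0 and 1. *)
Lemma pair_coef_row_zero (m : rat) (i : 'I_6) : m != 0 ->
  [exists j, (j != i) && (pair_coef m i j == 0)] = (m == 1) || (1 < i)%N.
Proof.
move=> m0; have A0 : (m - 2%:R + m^-1 == 0) = (m == 1).
  rewrite add_inv_sub2E // mulf_eq0 sqrf_eq0 invr_eq0 (negPf m0) orbF.
  by rewrite subr_eq0.
apply/existsP/idP => [[j] | ].
  move: i j; do 2!apply: ord6_ind => //=; rewrite /pair_coef /= ?A0 ?orbT ?orbF //;
    by rewrite ?invr_eq0 ?oner_eq0 ?(negPf m0).
move: i; apply: ord6_ind; rewrite /= ?orbF ?orbT => m1.
- by exists (o 1); rewrite /pair_coef /= A0.
- by exists (o 0); rewrite /pair_coef /= A0.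
- by exists (o 3).
- by exists (o 2).
- by exists (o 5).
- by exists (o 4).
Qed.

(** Clearing denominators gives m^2 = n^2 and (m - 1)^2 = (n - 1)^2; their difference is linear. *)
Lemma cross_ratios_eq (m n : rat) : m != 0 -> n != 0 ->
  m / n = n / m -> (m - 1) ^+ 2 / m / n = (n - 1) ^+ 2 / n / m -> m = n.
Proof.
move=> m0 n0 E1 E2.
have sq1 : m ^+ 2 = n ^+ 2.
  transitivity (m * n * (m / n)); first by field.
  by rewrite E1; field.
have sq2 : (m - 1) ^+ 2 = (n - 1) ^+ 2.
  transitivity (m * n * ((m - 1) ^+ 2 / m / n)); first by field; rewrite m0 n0.
  by rewrite E2; field; rewrite m0 n0.
lra.
Qed.

Lemma pair_coef_rigid (m m' mu : rat) (s : 'I_6 -> 'I_6) (d : 'I_6 -> rat) :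
  m != 0 -> m' != 0 -> injective s -> (forall i, d i != 0) -> mu != 0 ->
  (forall i j, i != j ->
    pair_coef m i j * (d i * d j) = mu * pair_coef m' (s i) (s j)) ->
  m = m' \/ m * m' = 1.
Proof.
move=> m0 m'0 s_inj d0 mu0 eqs.
have sK : cancel (invF s_inj) s by exact: f_invF.
have zs i j : i != j ->
    (pair_coef m i j == 0) = (pair_coef m' (s i) (s j) == 0).
  move=> ij; have := congr1 (eq_op^~ 0) (eqs i j ij).
  by rewrite !mulf_eq0 (negPf (d0 _)) (negPf (d0 _)) (negPf mu0) !orbF.
have rs (i : 'I_6) : (m == 1) || (1 < i)%N = (m' == 1) || (1 < s i)%N.
  rewrite -!pair_coef_row_zero //; apply/existsP/existsP => -[j /andP[ji z]].
    by exists (s j); rewrite (inj_eq s_inj) ji /= -zs // eq_sym.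
  exists (invF s_inj j); rewrite -(inj_eq s_inj) sK ji zs ?sK //.
  by rewrite eq_sym -(inj_eq s_inj) sK.
case: (eqVneq m 1) rs => [m1 | m1] rs.
  (* For m = 1 every row has a zero, so row 0 for m' has one too, whence m' = 1. *)
  left; have := rs (invF s_inj (o 0)).
  by rewrite sK m1 orbF => /esym/eqP.
case: (eqVneq m' 1) rs => [m'1 | m'1] rs; first by have := rs (o 0).
(* In the cross ratios the scaling factors [d] and [mu] cancel. *)
have cross i j k l : [&& i != j, k != l, i != l & k != j] ->
    pair_coef m i j * pair_coef m k l
      * (pair_coef m' (s i) (s l) * pair_coef m' (s k) (s j)) =
    pair_coef m i l * pair_coef m k j
      * (pair_coef m' (s i) (s j) * pair_coef m' (s k) (s l)).
  move=> /and4P[/eqs ij /eqs kl /eqs il /eqs kj].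
  have D0 : mu ^+ 2 * (d i * d j * d k * d l) != 0.
    by rewrite !mulf_neq0 ?expf_neq0.
  apply: (mulfI D0).
  transitivity ((pair_coef m i j * (d i * d j)) * (pair_coef m k l * (d k * d l))
    * ((mu * pair_coef m' (s i) (s l)) * (mu * pair_coef m' (s k) (s j)))).
    ring.
  rewrite ij kl -il -kj; ring.
(* For m these two cross ratios are m^2 and (m - 1)^2. *)
have E1 := cross (o 0) (o 2) (o 1) (o 5) isT.
have E2 := cross (o 0) (o 1) (o 2) (o 5) isT.
have := zs (o 2) (o 5) isT.
move: E1 E2 (rs (o 0)) (rs (o 1)) (rs (o 2)) (rs (o 5)) => /=.
have : s (o 0) != s (o 1) by rewrite (inj_eq s_inj).
move: (s (o 0)) (s (o 1)) (s (o 2)) (s (o 5)) => s0 s1 s2 s5.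
move: s0 s1; do 2!apply: ord6_ind => //=.
all: move=> _; move: s2 s5; do 2!apply: ord6_ind => //=.
all: rewrite /pair_coef /= !add_inv_sub2E // => E1 E2 _ _ _ _ //.
(* [s] preserves {0, 1} and sends 2 and 5 to different blocks among {2, 3}, {4, 5}. If it swaps 0
   and 1 and also the blocks, or does neither, the ratios are those of m'; if it does just one,
   those of 1/m'. *)
all: first
  [ by left; apply: cross_ratios_eq => //; [move: E1 | move: E2]; lra
  | right; suff -> : m = m'^-1 by rewrite mulVf].
all: apply: cross_ratios_eq; rewrite ?invr_eq0 // invrK; first by move: E1; lra.
all: have -> : (m'^-1 - 1) ^+ 2 * m' = (m' - 1) ^+ 2 / m' by field.
all: by move: E2; lra.
Qed.

(** * The converse *)

Lemma mpoly_incl_id (K : fieldType) (n : nat) (le_nn : (n <= n)%N)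
    (q : {mpoly K[n]}) : mpoly_incl le_nn q = q.
Proof. by rewrite -[RHS]comp_mpoly_id /mpoly_incl; congr (_ \mPo _). Qed.

Lemma lin_contact_equiv_refl (K : fieldType) (n : nat) (q : {mpoly K[n]}) :
  lin_contact_equiv q q.
Proof.
exists n, (leqnn n), (leqnn n), 1%:M, 1; split; rewrite ?unitmx1 ?oner_eq0 //.
rewrite scale1r !mpoly_incl_id -[LHS]comp_mpoly_id; congr (_ \mPo _).
apply: eq_mktuple => i; rewrite (bigD1 i) //= mxE eqxx scale1r big1 ?addr0 //.
by move=> j ji; rewrite mxE eq_sym (negPf ji) scale0r.
Qed.

(** Swap the first two rows and columns of the matrix, then multiply the fourth row and column by n:
    its entries m t, t become n t, t, and the determinant gains the factor n^2. *)
Lemma psi_expr_inv (R : comNzRingType) (m n y1 y2 y3 y4 s t : R) :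
  m * n = 1 ->
  psi_expr m y1 y2 y3 y4 s t = m ^+ 2 * psi_expr n y2 y1 y3 (n ^+ 2 * y4) s t.
Proof. by move=> mn; rewrite /psi_expr; ring: mn. Qed.

Lemma psi_inv_equiv (m m' : rat) : m * m' = 1 ->
  lin_contact_equiv (psi m) (psi m').
Proof.
move=> mm'; have m0 : m != 0.
  by apply: contra_eq_neq mm' => ->; rewrite mul0r eq_sym oner_eq0.
pose l (c : rat) : 'M[rat]_6 := \matrix_(i, j) nth 0 (nth [::]
    [:: [:: 0; 1; 0; 0; 0; 0];
        [:: 1; 0; 0; 0; 0; 0];
        [:: 0; 0; 1; 0; 0; 0];
        [:: 0; 0; 0; c; 0; 0];
        [:: 0; 0; 0; 0; 1; 0];
        [:: 0; 0; 0; 0; 0; 1]] i) j.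
exists 6%N, (leqnn 6), (leqnn 6), (l (m' ^+ 2)), (m ^+ 2); split.
- suff /mulmx1_unit[] : l (m' ^+ 2) *m l (m ^+ 2) = 1%:M by [].
  apply/matrixP; do 2!apply: ord6_ind; rewrite !mxE sum6 !mxE /=; try ring.
  by rewrite !mul0r !add0r !addr0 -exprMn mulrC mm' expr1n.
- by rewrite expf_neq0.
rewrite !mpoly_incl_id /mpoly_lin_comp !psiE.
set lq := [tuple _ | _ < _].
rewrite (rmorph_psi_expr (comp_mpoly lq)) /= comp_mpolyC /y !comp_mpolyXU.
rewrite -!tnth_nth !tnth_mktuple !sum6 !mxE !inordK //=.
rewrite !scale0r !scale1r !add0r !addr0.
rewrite (@psi_expr_inv _ _ m'%:MP) -?mpolyCM ?mm' //.
rewrite -!mul_mpolyC !rmorphXn /=.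
by rewrite -[o 0]inord_val -[o 1]inord_val -[o 2]inord_val -[o 3]inord_val
  -[o 4]inord_val -[o 5]inord_val.
Qed.

Theorem proposition8p2 (m m' : rat) (hm : m != 0) (hm' : m' != 0) :
  lin_contact_equiv (psi m) (psi m') <-> m = m' \/ m * m' = 1.
Proof.
split=> [/(equiv_basis_fun hm hm') [N [lam eqN]]|[<-|]].
- have [s [d [mu [s_inj d0 mu0 eqs]]]] := pair_coef_monomial hm hm' eqN.
  exact: pair_coef_rigid hm hm' s_inj d0 mu0 eqs.
- exact: lin_contact_equiv_refl.
- exact: psi_inv_equiv.
Qed.
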